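(* Let $\mathcal{B}=(\mathbf{x}_n)_{n=1}^\infty$ be an $M$-bounded semi-normalized basis in a quasi-Banach space $\mathbb{X}$. The following conditions are equivalent. (i) $\mathcal{B}$ is quasi-greedy. (ii) For every $f\in\mathbb{X}$ the greedy series of $f$ converges. (iii) For every $f\in\mathbb{X}$ the greedy algorithm $(\mathcal{G}_m(f))_{m=1}^\infty$ is bounded.
   Context: The scalar field is $\mathbb{R}$ or $\mathbb{C}$. A quasi-norm satisfies the axioms of a norm except that the triangle inequality is replaced by $\Vert f+g\Vert\le\kappa(\Vert f\Vert+\Vert g\Vert)$ for some constant $\kappa\ge1$; a quasi-Banach space is a vector space complete for the topology of a quasi-norm. A basis of $\mathbb{X}$ is a sequence $\mathcal{B}=(\mathbf{x}_n)_{n=1}^\infty$ whose closed linear span is $\mathbb{X}$ and for which there is a (unique) sequence $(\mathbf{x}_n^* )_{n=1}^\infty$ in $\mathbb{X}^*$ with $\mathbf{x}_n^*(\mathbf{x}_k)=\delta_{k,n}$. It is $M$-bounded if $\sup_n\Vert\mathbf{x}_n\Vert\,\Vert\mathbf{x}_n^*\Vert<\infty$ and semi-normalized if $0<\inf_n\Vert\mathbf{x}_n\Vert\le\sup_n\Vert\mathbf{x}_n\Vert<\infty$; under both conditions $(\mathbf{x}_n^*(f))_{n=1}^\infty\in c_0$ for every $f\in\mathbb{X}$. For finite $A\subseteq\mathbb{N}$, $S_A(f)=\sum_{n\in A}\mathbf{x}_n^*(f)\mathbf{x}_n$. A set $A\subseteq\mathbb{N}$ is a greedy set of $f$ if $|\mathbf{x}_k^*(f)|\le|\mathbf{x}_n^*(f)|$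 for all $n\in A$ and $k\in\mathbb{N}\setminus A$. An $M$-bounded semi-normalized basis is quasi-greedy if there is a constant $C<\infty$ with $\Vert S_A(f)\Vert\le C\Vert f\Vert$ for all $f\in\mathbb{X}$ and all finite greedy sets $A$ of $f$. For $f\in\mathbb{X}$ and $m\ge0$, the $m$th greedy set $A_m(f)$ is the unique set $A\subseteq\mathbb{N}$ with $|A|=m$ such that for all $n\in A$, $k\in\mathbb{N}\setminus A$, either $|\mathbf{x}_n^*(f)|>|\mathbf{x}_k^*(f)|$, or $|\mathbf{x}_n^*(f)|=|\mathbf{x}_k^*(f)|$ and $n<k$. Put $\mathcal{G}_m(f)=S_{A_m(f)}(f)$. Since $A_m(f)\subseteq A_{m+1}(f)$, there is a unique injection $\phi_f\colon\mathbb{N}\to\mathbb{N}$ with $A_m(f)=\{\phi_f(j):1\le j\le m\}$ for all $m$. The greedy series of $f$ is the formal series $\sum_{j=1}^\infty\mathbf{x}_{\phi_f(j)}^*(f)\,\mathbf{x}_{\phi_f(j)}$, whose $m$th partial sum is $\mathcal{G}_m(f)$. *)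

(* Defs.v *)
From HB Require Import structures.
From mathcomp Require Import all_boot all_order all_algebra.
From mathcomp Require Import finmap.
From mathcomp Require Import all_classical all_reals all_analysis.
From mathcomp Require Import complex.

Set Implicit Arguments.
Unset Strict Implicit.
Unset Printing Implicit Defensive.

Import Order.TTheory GRing.Theory Num.Theory.
Import numFieldNormedType.Exports.

Local Open Scope classical_set_scope.
Local Open Scope ring_scope.

Inductive scalar_kind := RealScalars | ComplexScalars.

Definition scalars (R : realType) (k : scalar_kind) : numFieldType :=
  match k with
  | RealScalars => R
  | ComplexScalars => (R[i] : numFieldType)
  end.

(* The modulus is taken in [R]: the library norm on [R[i]] is [R[i]]-valued. *)
Definition modulus (R : realType) (k : scalar_kind) : scalars R k -> R :=
  match k return scalars R k -> R with
  | RealScalars => fun a : R => `|a|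
  | ComplexScalars => fun a : R[i] => complex.Re `|a|
  end.

(* The uniform structure (hence the topology) is required to be the one
   generated by the quasi-norm, so that convergence, continuity, closure and
   completeness are those of the library. [uniformLmodType] is not used: it
   asks for uniform continuity of the scaling on all of [K * X]. *)
HB.mixin Record isQuasiNormed (R : realType) (k : scalar_kind) X
    & Uniform X & GRing.Lmodule (scalars R k) X := {
  qnorm : X -> R;
  qnorm_ge0 : forall f, 0 <= qnorm f;
  qnorm_eq0 : forall f, qnorm f = 0 -> f = 0;
  qnormZ : forall (a : scalars R k) f, qnorm (a *: f) = modulus a * qnorm f;
  qnorm_triangle : exists2 kappa : R, 1 <= kappa &
    forall f g, qnorm (f + g) <= kappa * (qnorm f + qnorm g);
  qnorm_entourage : entourage =
    filter_from [set e : R | 0 < e]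
      (fun e => [set fg : X * X | qnorm (fg.1 - fg.2) < e])
}.

#[short(type="quasiNormedModType")]
HB.structure Definition QuasiNormedModule (R : realType) (k : scalar_kind) :=
  {X of Uniform X & GRing.Lmodule (scalars R k) X & isQuasiNormed R k X}.

(* The library's [Complete] adds a choice of base point, which has no common
   ancestor with the algebraic structures; this is its axiom alone. *)
HB.mixin Record QuasiNormed_isComplete (R : realType) (k : scalar_kind) X
    & QuasiNormedModule R k X := {
  qnorm_cauchy_cvg : forall F : set_system X,
    ProperFilter F -> cauchy F -> exists f : X, F --> f
}.

#[short(type="quasiBanachType")]
HB.structure Definition QuasiBanach (R : realType) (k : scalar_kind) :=
  {X of QuasiNormedModule R k X & QuasiNormed_isComplete R k X}.

Section Bases.
Context {R : realType} {k : scalar_kind} {X : quasiNormedModType R k}.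
Local Notation K := (scalars R k).

Definition linear_span (x : nat -> X) : set X :=
  [set f | exists (n : nat) (a : nat -> K), f = \sum_(i < n) a i *: x i].

(* The operator norm of a functional, possibly infinite. *)
Definition dual_norm (g : X -> K) : \bar R :=
  ereal_sup [set (modulus (g f))%:E | f in [set f : X | qnorm f <= 1]].

(* Sequences are indexed from 0. The coordinate functionals are carried along
   as data; they are determined by the basis, by density of its span. *)
Record seq_basis := SeqBasis {
  basis_vec :> nat -> X;
  coord_fun : nat -> {linear X -> K^o};
  coord_fun_continuous : forall n, continuous (coord_fun n);
  basis_dense : closure (linear_span basis_vec) = setT;
  basis_biorthogonal : forall n j, coord_fun n (basis_vec j) = (j == n)%:R
}.

Implicit Types (B : seq_basis) (f : X).

Definition m_bounded B : Prop :=
  (ereal_sup (range (fun n => (qnorm (B n))%:E * dual_norm (coord_fun B n)))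
    < +oo)%E.

Definition semi_normalized B : Prop :=
  (0 < ereal_inf (range (fun n => (qnorm (B n))%:E)))%E /\
  (ereal_sup (range (fun n => (qnorm (B n))%:E)) < +oo)%E.

Definition coord_sum B (A : {fset nat}) f : X :=
  \sum_(n <- A) (coord_fun B n f : K) *: B n.

Definition greedy_set B f (A : set nat) : Prop :=
  forall n j, A n -> ~ A j ->
    modulus (coord_fun B j f : K) <= modulus (coord_fun B n f : K).

Definition quasi_greedy B : Prop :=
  exists C : R, forall f (A : {fset nat}), greedy_set B f [set` A] ->
    qnorm (coord_sum B A f) <= C * qnorm f.

Definition is_mth_greedy_set B f (m : nat) (A : {fset nat}) : Prop :=
  #|` A| = m /\
  forall n j, n \in A -> j \notin A ->
    modulus (coord_fun B j f : K) < modulus (coord_fun B n f : K) \/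
    modulus (coord_fun B n f : K) = modulus (coord_fun B j f : K) /\ (n < j)%N.

(* The default values of [xget] below are never used when the coordinates of
   [f] tend to 0, in particular for M-bounded semi-normalized bases. *)
Definition mth_greedy_set B f (m : nat) : {fset nat} :=
  xget fset0 [set A | is_mth_greedy_set B f m A].

Definition greedy_sum B f (m : nat) : X :=
  coord_sum B (mth_greedy_set B f m) f.

Definition greedy_ordering B f : nat -> nat :=
  xget (id : nat -> nat) [set phi : nat -> nat | injective phi /\
    forall m, [set` mth_greedy_set B f m] = phi @` `I_m].

Definition greedy_series B f : nat -> X :=
  series (fun j => (coord_fun B (greedy_ordering B f j) f : K)
                     *: B (greedy_ordering B f j)).

End Bases.

Arguments seq_basis {R k} X.

(* Main.v *)
Require Import Defs.
From HB Require Import structures.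
From mathcomp Require Import all_boot all_order all_algebra.
From mathcomp Require Import finmap.
From mathcomp Require Import all_classical all_reals all_analysis.
From mathcomp Require Import complex lra.

(* (i) => (ii): the greedy series of [f] converges to [f] itself. If [g] has
   finite support and is close to [f] then, for large [m], [G_m(f) - g] is the
   coordinate sum of [f - g] over one of its greedy sets, hence is small.
   (ii) => (iii): convergent sequences are bounded.
   (iii) => (i): call [A] gap-greedy for [f] if the coordinates on [A] exceed in
   modulus those outside [A] by a fixed positive amount; this is an open
   condition, under which [S_A(f)] is some [G_m(f)]. By a Baire category
   argument, [S_A(f)] is bounded over all [f] in some ball and all [A]
   gap-greedy for [f]. Recentring the ball at a finitely supported vector and
   using homogeneity gives [|S_A(h)| <= D |h|] for the [h] that vanish on a fixed
   finite set [F]. Enlarging slightly the coordinates on [A] passes from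
   gap-greedy sets to all greedy sets, and subtracting [S_F(f)] to all [f]. *)

Import Order.TTheory GRing.Theory Num.Theory.
Import numFieldNormedType.Exports.

Local Open Scope classical_set_scope.
Local Open Scope ring_scope.

(** * The modulus on real and complex scalars *)

Section Modulus.
Context {R : realType} {k : scalar_kind}.
Local Notation K := (scalars R k).
Implicit Types a b : K.

Lemma modulus_ge0 a : 0 <= modulus a.
Proof.
case: k a => [|] a; first exact: normr_ge0.
by case: a => x y /=; rewrite sqrtr_ge0.
Qed.

Lemma modulus_eq0 a : modulus a = 0 -> a = 0.
Proof.
case: k a => [|] a; last exact: Normc.eq0_normc.
by move=> a0; apply/eqP; rewrite -normr_eq0; apply/eqP.
Qed.

Lemma modulus_gt0 a : a != 0 -> 0 < modulus a.
Proof.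
by move=> a0; rewrite lt0r modulus_ge0 andbT; apply: contra_neq a0 => /modulus_eq0.
Qed.

Lemma modulusM a b : modulus (a * b) = modulus a * modulus b.
Proof. by case: k a b => [|] a b; [exact: normrM|exact: Normc.normcM]. Qed.

Lemma modulusD a b : modulus (a + b) <= modulus a + modulus b.
Proof. by case: k a b => [|] a b; [exact: ler_normD|exact: le_normcD]. Qed.

Lemma modulusN a : modulus (- a) = modulus a.
Proof. by case: k a => [|] a; [exact: normrN|exact: normcN]. Qed.

Lemma modulus0 : modulus (0 : K) = 0.
Proof. by case: k; [exact: normr0|exact: Normc.normc0]. Qed.

Lemma modulus1 : modulus (1 : K) = 1.
Proof. by case: k; [exact: normr1|exact: Normc.normc1]. Qed.

Definition scalar_of (t : R) : K :=
  match k return scalars R k with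
  | RealScalars => t
  | ComplexScalars => (t%:C)%C
  end.

Lemma modulus_scalar_of (t : R) : modulus (scalar_of t) = `|t|.
Proof.
rewrite /scalar_of; case: k => //=.
by rewrite expr0n addr0 sqrtr_sqr.
Qed.

Lemma scalar_ofD1 (t : R) : scalar_of (1 + t) = 1 + scalar_of t.
Proof. by rewrite /scalar_of; case: k => //=; rewrite rmorphD. Qed.

Lemma modulus_le_sub a b : modulus a - modulus b <= modulus (a - b).
Proof. by rewrite lerBlDr (le_trans _ (modulusD _ _)) // subrK. Qed.

(** A nonzero [a] is moved radially outward, by its multiple of modulus [e]; at 0 every direction is
    outward. This later opens a gap between a greedy set and its complement. *)
Lemma modulus_push a (e : R) : 0 <= e ->
  exists b : K, modulus b = e /\ modulus (a + b) = modulus a + e.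
Proof.
move=> e0; have [->|a0] := eqVneq a 0.
  by exists (scalar_of e); rewrite add0r modulus0 add0r modulus_scalar_of ger0_norm.
have ma : modulus a != 0 by rewrite gt_eqF ?modulus_gt0.
have q0 : 0 <= e / modulus a by rewrite divr_ge0 ?modulus_ge0.
exists (scalar_of (e / modulus a) * a).
rewrite -{3}[a]mul1r -mulrDl -scalar_ofD1 !modulusM !modulus_scalar_of.
by rewrite !ger0_norm ?addr_ge0 // mulrDl mul1r divfK.
Qed.

End Modulus.

(** * The topology of a quasi-norm *)

Section QuasiNorm.
Context {R : realType} {k : scalar_kind} {X : quasiNormedModType R k}.
Local Notation K := (scalars R k).
Implicit Types f g : X.

Lemma qnorm0 : qnorm (0 : X) = 0.
Proof. by rewrite -(scale0r (0 : X)) qnormZ modulus0 mul0r. Qed.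

Lemma qnormN f : qnorm (- f) = qnorm f.
Proof.
rewrite -scaleN1r qnormZ modulusN.
by rewrite modulus1 mul1r.
Qed.

Lemma qnormB f g : qnorm (f - g) = qnorm (g - f).
Proof. by rewrite -qnormN opprB. Qed.

(** A quasi-norm may be discontinuous and its balls need not be open, but they still form a
    neighbourhood base. *)
Lemma qnorm_nbhsP f (A : set X) :
  nbhs f A <-> exists2 e : R, 0 < e & forall g, qnorm (f - g) < e -> A g.
Proof.
rewrite -nbhs_entourageE /nbhs_ /= qnorm_entourage; split.
  move=> [E [e e0 eE] EA]; exists e => // g fg; apply: EA.
  by rewrite /xsection /= inE; apply: eE.
move=> [e e0 eA]; exists [set fg : X * X | qnorm (fg.1 - fg.2) < e].
  by exists e.
by move=> g; rewrite /xsection /= inE; apply: eA.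
Qed.

Lemma qnorm_cvgP (u : nat -> X) f :
  u @ \oo --> f <-> forall e : R, 0 < e -> \forall n \near \oo, qnorm (f - u n) < e.
Proof.
split=> [uf e e0|uf A /qnorm_nbhsP[e e0 eA]].
  by apply: (uf [set g | qnorm (f - g) < e]); apply/qnorm_nbhsP; exists e.
by have := uf e e0; apply: filterS => n /eA.
Qed.

End QuasiNorm.

(** * Existence and uniqueness of greedy sets; partial sums of the greedy series *)

Section GreedyOrdering.
Context {R : realType} {k : scalar_kind} {X : quasiNormedModType R k}.
Local Notation K := (scalars R k).
Variables (B : seq_basis X) (f : X).
Local Notation coord n f := (coord_fun B n f : K).
Hypothesis coord_tends_to0 : forall e : R, 0 < e ->
  exists N, forall n, (N <= n)%N -> modulus (coord n f) < e.

Let u n := modulus (coord n f).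
Let precedes n j := u j < u n \/ u n = u j /\ (n < j)%N.

Let precedes_asym n j : precedes n j -> precedes j n -> False.
Proof.
move=> [nj|[nj ltnj]] [jn|[jn ltjn]]; try lra.
by have := ltn_trans ltnj ltjn; rewrite ltnn.
Qed.

(** If some coordinate off [A] is nonzero, only finitely many are as large, and a finite maximum is
    taken; otherwise any index past [A] will do. *)
Lemma largest_coord (A : {fset nat}) : exists2 n, n \notin A &
  forall j, j \notin A -> u j <= u n.
Proof.
have [[j0 [j0A uj0]]|nex] := pselect (exists j, j \notin A /\ 0 < u j).
  have [N uN] := coord_tends_to0 _ uj0.
  have j0N : (j0 < N)%N.
    by rewrite ltnNge; apply/negP => /uN; rewrite -/(u j0) ltxx.
  pose i0 := Ordinal j0N.
  have [i iA imax] := @arg_maxP _ _ _ i0 (fun i : 'I_N => val i \notin A)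
    (fun i : 'I_N => u i) j0A.
  exists (val i) => // j jA; have [jN|Nj] := ltnP j N.
    exact: (imax (Ordinal jN)).
  by rewrite (le_trans (ltW (uN _ Nj))) //; exact: (imax i0).
exists (\max_(i <- A) i).+1.
  by apply/negP => nA; have := @leq_bigmax_seq _ _ xpredT id _ nA isT; rewrite ltnn.
move=> j jA; rewrite (@le_trans _ _ 0) ?modulus_ge0 // leNgt.
by apply/negP => uj; apply: nex; exists j.
Qed.

Lemma first_coord (A : {fset nat}) : exists n, n \notin A /\
  forall j, j \notin A -> j != n -> precedes n j.
Proof.
have [n0 n0A n0max] := largest_coord A.
have ex : exists n, (n \notin A) && (u n == u n0) by exists n0; rewrite n0A eqxx.
case: (ex_minnP ex) => n /andP[nA /eqP un] nmin.
exists n; split=> // j jA jn.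
have := n0max j jA; rewrite -un le_eqVlt => /orP[/eqP ujn|]; last by left.
right; split=> //; rewrite ltn_neqAle eq_sym jn nmin //.
by rewrite jA ujn un eqxx.
Qed.

(** Distinct sets of equal size each contain an index missing from the other, and these two indices
    would precede one another. *)
Lemma is_mth_greedy_set_uniq m (A A' : {fset nat}) :
  is_mth_greedy_set B f m A -> is_mth_greedy_set B f m A' -> A = A'.
Proof.
move=> [Am gA] [A'm gA']; apply/eqP; rewrite eqEfcard Am A'm leqnn andbT.
apply/negPn/negP => /fsubsetPn[n nA nA'].
have /fsubsetPn[j jA' jA] : ~~ (A' `<=` A)%fset.
  apply/negP => sA'A; have /eqP A'A : A' == A by rewrite eqEfcard sA'A Am A'm leqnn.
  by move: nA'; rewrite A'A nA.
exact: (precedes_asym _ _ (gA _ _ nA jA) (gA' _ _ jA' nA')).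
Qed.

Lemma greedy_ordering_exists : exists phi : nat -> nat, injective phi /\
  forall m, exists2 A, is_mth_greedy_set B f m A & [set` A] = phi @` `I_m.
Proof.
have [pick pickP] := choice first_coord.
(* [S m] collects the first [m] picks, each being the first index not yet taken; the ordering is
   [pick \o S]. *)
pose S := fix S m := if m is m'.+1 then (pick (S m') |` S m')%fset else fset0.
have S_mem m n : n \in S m -> exists2 j, (j < m)%N & n = pick (S j).
  elim: m => [|m IH] /=; first by rewrite inE.
  rewrite !inE => /orP[/eqP->|/IH[j jm ->]]; first by exists m.
  by exists j => //; exact: ltnW.
have S_pick m j : (j < m)%N -> pick (S j) \in S m.
  elim: m => [|m IH] //=; rewrite ltnS leq_eqVlt !inE => /orP[/eqP->|/IH->].
    by rewrite eqxx.
  by rewrite orbT.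
exists (pick \o S); split=> [i j /= ij|m].
  case: (ltngtP i j) => // [/S_pick|/S_pick].
    by rewrite ij (negPf (pickP (S j)).1).
  by rewrite -ij (negPf (pickP (S i)).1).
exists (S m).
  elim: m => [|m [Sm gm]]; first by split=> //; rewrite cardfs0.
  have [pN pP] := pickP (S m); split=> [|n j]; first by rewrite /= cardfsU1 pN Sm.
  rewrite /= !inE negb_or => /orP[/eqP->|nS] /andP[jp jS]; first exact: pP.
  exact: gm.
apply/seteqP; split=> [n /S_mem[j jm ->]|n [j jm <-]]; first by exists j.
exact: S_pick.
Qed.

Lemma mth_greedy_setP m : is_mth_greedy_set B f m (mth_greedy_set B f m).
Proof.
have [phi [_ /(_ m)[A Am _]]] := greedy_ordering_exists.
by apply: xgetPex; exists A.
Qed.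

Lemma mth_greedy_setE m A : is_mth_greedy_set B f m A -> mth_greedy_set B f m = A.
Proof. by apply: is_mth_greedy_set_uniq; exact: mth_greedy_setP. Qed.

Lemma greedy_seriesE m : greedy_series B f m = greedy_sum B f m.
Proof.
(* Once such an ordering is known to exist, [xget] does not return its default value. *)
have [phi_inj phiE] : injective (greedy_ordering B f) /\ forall m,
    [set` mth_greedy_set B f m] = greedy_ordering B f @` `I_m.
  have [phi [phi_inj phiP]] := greedy_ordering_exists.
  rewrite /greedy_ordering; case: xgetP => [psi _ //|/(_ phi)[]].
  split=> // i; have [A Ai <-] := phiP i.
  by rewrite (mth_greedy_setE _ _ Ai).
rewrite /greedy_series /greedy_sum /coord_sum /series /=.
rewrite -(big_map (greedy_ordering B f) xpredT (fun n => coord n f *: B n)).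
apply: perm_big; rewrite uniq_perm ?fset_uniq ?map_inj_uniq ?iota_uniq // => n.
have := congr1 (fun S : set nat => S n) (phiE m) => /= nE.
apply/mapP/idP => [[j]|].
  rewrite mem_index_iota => /andP[_ jm] ->.
  have : (greedy_ordering B f @` `I_m) (greedy_ordering B f j) by exists j.
  by rewrite -phiE.
by rewrite nE => -[j jm <-]; exists j => //; rewrite mem_index_iota.
Qed.

End GreedyOrdering.

Lemma seq_positive_lbound {R : realDomainType} {T : eqType} (s : seq T)
    (w : T -> R) :
  {in s, forall n, 0 < w n} -> exists2 d, 0 < d & {in s, forall n, d <= w n}.
Proof.
elim: s => [|m s IH] w0; first by exists 1; rewrite ?ltr01.
have [n ns|d d0 ds] := IH; first by rewrite w0 // inE ns orbT.
exists (Num.min d (w m)) => [|n]; first by rewrite lt_min d0 w0 ?mem_head.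
by rewrite inE ge_min => /orP[/eqP->|/ds->//]; rewrite lexx orbT.
Qed.

(** * Coordinates and coordinate sums with respect to a basis *)

Section BasisCoordinates.
Context {R : realType} {k : scalar_kind} {X : quasiNormedModType R k}.
Local Notation K := (scalars R k).
Implicit Types (f g h : X) (A F : {fset nat}).

Variable B : seq_basis X.
Local Notation coord n f := (coord_fun B n f : K).

Lemma coordD n f g : coord n (f + g) = coord n f + coord n g.
Proof. exact: linearD. Qed.

Lemma coordB n f g : coord n (f - g) = coord n f - coord n g.
Proof. exact: linearB. Qed.

Lemma coordZ n (a : K) f : coord n (a *: f) = a * coord n f.
Proof. exact: linearZ. Qed.

Lemma coord_sumD A f g : coord_sum B A (f + g) = coord_sum B A f + coord_sum B A g.
Proof.
by rewrite /coord_sum -big_split; apply: eq_bigr => n _; rewrite coordD scalerDl.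
Qed.

Lemma coord_sumZ A (a : K) f : coord_sum B A (a *: f) = a *: coord_sum B A f.
Proof.
by rewrite /coord_sum scaler_sumr; apply: eq_bigr => n _; rewrite coordZ scalerA.
Qed.

Lemma coord_sumB A f g : coord_sum B A (f - g) = coord_sum B A f - coord_sum B A g.
Proof. by rewrite -scaleN1r coord_sumD coord_sumZ scaleN1r. Qed.

Lemma eq_coord_sum A f g : {in A, forall n, coord n f = coord n g} ->
  coord_sum B A f = coord_sum B A g.
Proof. by move=> fg; apply: eq_big_seq => n /fg ->. Qed.

Lemma coord_combination A (a : nat -> K) j :
  coord j (\sum_(n <- A) a n *: B n) = if j \in A then a j else 0.
Proof.
have -> : coord j (\sum_(n <- A) a n *: B n) = \sum_(n <- A) a n * (n == j)%:R.
  rewrite (linear_sum (coord_fun B j)); apply: eq_bigr => n _.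
  by rewrite coordZ basis_biorthogonal.
case: ifPn => jA.
  rewrite (big_rem j) //= eqxx mulr1 big_seq big1 ?addr0 // => n.
  by rewrite mem_rem_uniq ?fset_uniq // inE => /andP[/negPf-> _]; rewrite mulr0.
rewrite big_seq big1 // => n nA; case: eqP => [nj|]; last by rewrite mulr0.
by move: jA; rewrite -nj nA.
Qed.

Lemma coord_coord_sum A f j :
  coord j (coord_sum B A f) = if j \in A then coord j f else 0.
Proof. exact: coord_combination. Qed.

Lemma coord_sum_sub F A f : (F `<=` A)%fset ->
  (forall n, n \in A -> n \notin F -> coord n f = 0) ->
  coord_sum B A f = coord_sum B F f.
Proof.
move=> FA f0; symmetry; rewrite /coord_sum; apply: (big_fset_incl _ FA) => n nA nF.
by rewrite f0 ?scale0r.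
Qed.

Lemma coord_sumID F A f :
  coord_sum B A f = coord_sum B (A `&` F)%fset f + coord_sum B (A `\` F)%fset f.
Proof.
rewrite /coord_sum (big_fsetID _ [pred n | n \in F]) /=; congr (_ + _).
  by congr bigop; congr enum_fset; apply/fsetP => n; rewrite !inE.
by congr bigop; congr enum_fset; apply/fsetP => n; rewrite !inE andbC.
Qed.

(** * Estimates with one constant [C], and convergence for quasi-greedy bases *)

Variables (C : R) (C_ge1 : 1 <= C).
Hypothesis qnorm_add : forall f g, qnorm (f + g) <= C * (qnorm f + qnorm g).
Hypothesis coord_le : forall n f, modulus (coord n f) <= C * qnorm f.
Hypothesis vec_le : forall n, qnorm (B n) <= C.

Let C_gt0 : 0 < C. Proof. exact: lt_le_trans ltr01 C_ge1. Qed.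
Let C_ge0 : 0 <= C. Proof. exact: ltW. Qed.

(** Every term costs another factor [C], so [D] depends on [s], but not on the coefficients. *)
Lemma combination_le (s : seq nat) : exists2 D : R, 0 <= D &
  forall (a : nat -> K) e, 0 <= e -> {in s, forall n, modulus (a n) <= e} ->
    qnorm (\sum_(n <- s) a n *: B n) <= D * e.
Proof.
elim: s => [|m s [D D0 IH]].
  by exists 0 => // a e e0 _; rewrite big_nil qnorm0 mul0r.
exists (C * (C + D)); first by rewrite mulr_ge0 ?addr_ge0.
move=> a e e0 ae; rewrite big_cons (le_trans (qnorm_add _ _)) // -mulrA.
rewrite ler_wpM2l // mulrDl lerD //.
  by rewrite qnormZ mulrC ler_pM ?qnorm_ge0 ?modulus_ge0 ?vec_le ?ae ?mem_head.
by apply: IH => // n ns; rewrite ae // inE ns orbT.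
Qed.

Lemma coord_sum_le F : exists2 D : R, 0 <= D &
  forall A f, (A `<=` F)%fset -> qnorm (coord_sum B A f) <= D * qnorm f.
Proof.
have [D D0 DF] := combination_le F; exists (D * C); first by rewrite mulr_ge0.
move=> A f AF.
have -> : coord_sum B A f =
    \sum_(n <- F) (if n \in A then coord n f else 0) *: B n.
  rewrite -(big_fset_incl _ AF) => [|n _ /negPf->]; last by rewrite scale0r.
  by apply: eq_big_seq => n ->.
rewrite -mulrA; apply: DF => [|n _]; first by rewrite mulr_ge0 ?qnorm_ge0.
by case: ifP => // _; rewrite modulus0 mulr_ge0 ?qnorm_ge0.
Qed.

Lemma finite_support_dense f (e : R) : 0 < e -> exists g F,
  [/\ qnorm (f - g) < e, coord_sum B F g = g & {in F, forall n, coord n g != 0}].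
Proof.
move=> e0; have fcl : closure (linear_span B) f by rewrite basis_dense.
have /fcl[g [[n [a ga]] fg]] : nbhs f [set g | qnorm (f - g) < e].
  by apply/qnorm_nbhsP; exists e.
pose s : {fset nat} := [fset i in iota 0 n]%fset.
have gs : g = \sum_(i <- s) a i *: B i.
  rewrite ga -(big_mkord xpredT (fun i => a i *: B i)); apply: perm_big.
  rewrite uniq_perm ?fset_uniq ?iota_uniq // => i.
  by rewrite /s !inE /= /index_iota subn0.
have sg : coord_sum B s g = g.
  rewrite {2}gs; apply: eq_big_seq => i si.
  by rewrite {1}gs coord_combination si.
exists g, [fset i in s | coord i g != 0]%fset; split => //.
  rewrite -[RHS]sg; symmetry; apply: coord_sum_sub.
    by apply/fsubsetP => i; rewrite !inE => /andP[].
  by move=> i; rewrite !inE => -> /=; rewrite negbK => /eqP.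
by move=> i; rewrite !inE => /andP[].
Qed.

(** Past the support of a finitely supported [g] near [f], the coordinates of [f] are those of
    [f - g], which are uniformly small. *)
Lemma coord_tail f (e : R) : 0 < e ->
  exists N, forall n, (N <= n)%N -> modulus (coord n f) < e.
Proof.
move=> e0; have [g [F [fg gF _]]] := finite_support_dense f _ (divr_gt0 e0 C_gt0).
exists (\max_(i <- F) i).+1 => n Fn.
have -> : coord n f = coord n (f - g).
  rewrite coordB -[in X in _ - X]gF coord_coord_sum ifF ?subr0 //.
  apply: contra_ltnF Fn => nF; rewrite (big_rem n) //= leq_maxl //.
by rewrite (le_lt_trans (coord_le _ _)) // mulrC -ltr_pdivlMr.
Qed.

Lemma coord_off_support F f : coord_sum B F f = f ->
  forall n, n \notin F -> coord n f = 0.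
Proof. by move=> <- n nF; rewrite coord_coord_sum (negPf nF). Qed.

Lemma qnormB_le f g : qnorm (f - g) <= C * (qnorm f + qnorm g).
Proof. by rewrite -[qnorm g]qnormN. Qed.

(* For [g] of finite support [F] close to [f] and [m] large, removing from
   [A_m(f) `|` F] the indices of the zero coordinates of [f - g] leaves a
   greedy set of [f - g], whose coordinate sum is [G_m(f) - g]. *)
Lemma quasi_greedy_cvg f : quasi_greedy B -> greedy_series B f @ \oo --> f.
Proof.
move=> [Q QP]; apply/qnorm_cvgP => e e0.
(* With [h = f - g], the error [f - G_m(f)] is [h] minus a greedy sum of [h], hence at most
   [C * (1 + |Q|)] times [qnorm h]. *)
have D0 : 0 < C * (1 + `|Q|) by rewrite mulr_gt0 // ltr_pwDl.
have [g [F [fg gF _]]] := finite_support_dense f _ (divr_gt0 e0 D0).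
have tail := coord_tail f.
set h := f - g in fg.
(* The value 1 at zero coordinates makes [d1] and [d2] positive lower bounds for the nonzero
   coordinates on [F] of [h] and of [f]. *)
pose w (x : X) n := if coord n x == 0 then 1 else modulus (coord n x).
have w0 x : {in F, forall n, 0 < w x n}.
  by move=> n _; rewrite /w; case: ifPn => // /modulus_gt0.
have [d1 d10 d1P] := seq_positive_lbound _ _ (w0 h).
have [d2 d20 d2P] := seq_positive_lbound _ _ (w0 f).
have [N NP] : exists N, forall n, (N <= n)%N -> modulus (coord n f) < Num.min d1 d2.
  by apply: tail; rewrite lt_min d10.
exists N.+1 => // m /= Nm; rewrite greedy_seriesE // /greedy_sum.
have [] := mth_greedy_setP B f tail m.
set A := mth_greedy_set B f m => Am gA.
have {}gA n j : n \in A -> j \notin A -> modulus (coord j f) <= modulus (coord n f).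
  by move=> nA jA; have [/ltW//|[-> _]] := gA n j nA jA.
(* [A] has more than [N] elements, so one of them is at least [N]; its coordinate is small and
   dominates all those outside [A]. *)
have small j : j \notin A -> modulus (coord j f) < Num.min d1 d2.
  have [n nA Nn] : exists2 n, n \in A & (N <= n)%N.
    apply: contrapT => /forall2NP nN.
    suff : (#|` A| <= size (iota 0 N))%N by rewrite size_iota Am leqNgt Nm.
    apply: uniq_leq_size => [|n nA]; first exact: fset_uniq.
    by rewrite mem_iota add0n /=; have [//|/negP] := nN n; rewrite -ltnNge.
  by move=> /(gA _ _ nA)/le_lt_trans; apply; exact: NP.
pose G := [fset n in (A `|` F)%fset | coord n h != 0]%fset.
have Gh : coord_sum B G h = coord_sum B A f - g.
  transitivity (coord_sum B (A `|` F)%fset h).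
    symmetry; apply: coord_sum_sub.
      by apply/fsubsetP => n; rewrite !inE => /andP[].
    by move=> n; rewrite !inE => -> /=; rewrite negbK => /eqP.
  rewrite coord_sumB; congr (_ - _).
    apply: coord_sum_sub; first exact: fsubsetUl.
    move=> n; rewrite !inE => /orP[->//|nF] nA; apply/eqP/negPn/negP => fn.
    have := small n nA; rewrite lt_min => /andP[_]; rewrite ltNge.
    by have := d2P n nF; rewrite /w (negPf fn) => ->.
  rewrite -[RHS]gF; apply: coord_sum_sub; first exact: fsubsetUr.
  by move=> n _; exact: coord_off_support.
(* Off [A] and [F], [h] has the coordinates of [f]: they lie below [d1], hence below those of [h] on
   [G] within [F], and greediness of [A] handles the rest of [G]. *)
have greedyG : greedy_set B h [set` G].
  move=> n j /=; rewrite !inE => /andP[nAF hn] /negP; rewrite negb_and negbK.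
  have [->|hj] := eqVneq (coord j h) 0; first by rewrite modulus0 modulus_ge0.
  rewrite orbF negb_or => /andP[jA jF].
  have -> : coord j h = coord j f.
    by rewrite coordB (coord_off_support _ _ gF) // subr0.
  have [nF|nF] := boolP (n \in F).
    rewrite ltW // (lt_le_trans (small _ jA)) // ge_min.
    by have := d1P n nF; rewrite /w (negPf hn) => ->.
  rewrite coordB (coord_off_support _ _ gF n) // subr0 gA //.
  by move: nAF; rewrite (negPf nF) orbF.
have := QP _ _ greedyG; rewrite Gh => Gg.
have -> : f - coord_sum B A f = h - (coord_sum B A f - g).
  by rewrite /h opprB addrA subrK.
have h0 := qnorm_ge0 h.
rewrite (le_lt_trans (qnormB_le _ _)) //.
move: fg; rewrite ltr_pdivlMr //; apply: le_lt_trans.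
rewrite [leRHS]mulrCA ler_wpM2l // mulrDr mulr1 lerD2l mulrC (le_trans Gg) //.
by rewrite ler_wpM2r // ler_norm.
Qed.

Lemma qnorm_cvg_bounded (u : nat -> X) g : u @ \oo --> g ->
  exists M : R, forall m, qnorm (u m) <= M.
Proof.
move=> /qnorm_cvgP/(_ _ ltr01)[N _ NP].
exists (C * (qnorm g + 1) + \sum_(i < N) qnorm (u i)) => m.
have [mN|Nm] := ltnP m N.
  rewrite (bigD1 (Ordinal mN)) //= addrCA lerDl addr_ge0 ?sumr_ge0 //.
    by rewrite mulr_ge0 ?addr_ge0 ?qnorm_ge0.
  by move=> i _; exact: qnorm_ge0.
rewrite -[u m](subKr g) ler_wpDr ?sumr_ge0 // => [i _|]; first exact: qnorm_ge0.
rewrite (le_trans (qnormB_le _ _)) // ler_wpM2l // lerD2l ltW //.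
exact: NP.
Qed.

(** * Gap-greedy sets and the passage to all greedy sets *)

Definition gap_greedy f A := exists2 c : R, 0 < c &
  forall n j, n \in A -> j \notin A ->
    modulus (coord j f) + c <= modulus (coord n f).

Lemma gap_greedy_sum f A : gap_greedy f A ->
  greedy_sum B f #|` A| = coord_sum B A f.
Proof.
move=> [c c0 gA]; rewrite /greedy_sum; congr (coord_sum B _ f).
apply: mth_greedy_setE; first exact: coord_tail.
by split=> // n j nA jA; left; rewrite (lt_le_trans _ (gA n j nA jA)) // ltrDl.
Qed.

Lemma gap_greedy_near f A : gap_greedy f A -> exists2 r : R, 0 < r &
  forall g, qnorm (f - g) < r -> gap_greedy g A.
Proof.
(* Each coordinate then moves by less than [c / 4], so half of the gap survives at every pair of
   indices. *)
move=> [c c0 gA]; exists (c / (4 * C)); first by rewrite divr_gt0 ?mulr_gt0.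
move=> g; rewrite ltr_pdivlMr ?mulr_gt0 // => fg.
exists (c / 2); first by rewrite divr_gt0.
move=> n j nA jA; have := gA n j nA jA.
have := modulus_le_sub (coord n f) (coord n g).
have := modulus_le_sub (coord j g) (coord j f).
rewrite -!coordB; have := coord_le n (f - g); have := coord_le j (g - f).
rewrite (qnormB g f); lra.
Qed.

Lemma gap_greedyZ (t : R) f A : 0 < t -> gap_greedy f A ->
  gap_greedy (scalar_of t *: f) A.
Proof.
move=> t0 [c c0 gA]; exists (t * c); first exact: mulr_gt0.
move=> n j nA jA; rewrite !coordZ !modulusM modulus_scalar_of gtr0_norm //.
by rewrite -mulrDr ler_pM2l // gA.
Qed.

Let avoids F h := {in F, forall n, coord n h = 0}.

(* Recentre the ball at a finitely supported [g], with support [F]: if [A] is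
   greedy for a small [h] vanishing on [F], then [F `|` A] is greedy for
   [g + h], with coordinate sum [g + S_A(h)]. *)
Lemma gap_greedy_le_of_ball (f0 : X) (r M : R) : 0 < r ->
  (forall f A, qnorm (f0 - f) < r -> gap_greedy f A ->
     qnorm (coord_sum B A f) <= M) ->
  exists F, exists2 D : R, 0 <= D &
    forall h A, avoids F h -> [disjoint F & A]%fset ->
    gap_greedy h A -> qnorm (coord_sum B A h) <= D * qnorm h.
Proof.
move=> r0 ball; have C2 : 0 < 2 * C by rewrite mulr_gt0.
have [g [F [fg gF gN0]]] :=
  finite_support_dense f0 _ (divr_gt0 r0 C2).
have [d d0 dP] : exists2 d, 0 < d & {in F, forall n, d <= modulus (coord n g)}.
  by apply: seq_positive_lbound => n /gN0; exact: modulus_gt0.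
(* The first bound keeps [g + h] in the ball about [f0]; the second keeps the coordinates of [h]
   below [d / 2], half the least modulus of [g] on [F]. *)
pose t := Num.min (r / (2 * C)) (d / (2 * C)).
have t0 : 0 < t by rewrite lt_min !divr_gt0.
pose M1 := C * (`|M| + qnorm g).
have M10 : 0 <= M1 by rewrite mulr_ge0 ?addr_ge0 ?qnorm_ge0.
have small h A : qnorm h < t -> avoids F h -> [disjoint F & A]%fset ->
    gap_greedy h A -> qnorm (coord_sum B A h) <= M1.
  rewrite lt_min => /andP[hr hd] hF /fdisjointP FA [c c0 hA].
  have gap : gap_greedy (g + h) (F `|` A)%fset.
    exists (Num.min c (d / 2)); first by rewrite lt_min c0 divr_gt0.
    move=> n j nFA; rewrite inE negb_or => /andP[jF jA].
    rewrite !coordD (coord_off_support _ _ gF j) // add0r.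
    have [nF|nF] := boolP (n \in F).
      rewrite (hF n nF) addr0 (le_trans _ (dP n nF)) // [leRHS]splitr lerD //.
        move: hd; rewrite ltr_pdivlMr // => hd.
        by have := coord_le j h; lra.
      by rewrite ge_min lexx orbT.
    have nA : n \in A by move: nFA; rewrite inE (negPf nF).
    rewrite (coord_off_support _ _ gF n) // add0r (le_trans _ (hA n j nA jA)) //.
    by rewrite lerD2l ge_min lexx.
  have hsum : coord_sum B (F `|` A)%fset (g + h) = g + coord_sum B A h.
    rewrite coord_sumD; congr (_ + _).
      rewrite -[RHS]gF; apply: coord_sum_sub; first exact: fsubsetUl.
      by move=> n _; exact: coord_off_support.
    apply: coord_sum_sub; first exact: fsubsetUr.
    by move=> n; rewrite inE => /orP[/hF//|->].
  have fgh : qnorm (f0 - (g + h)) < r.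
    rewrite opprD addrA (le_lt_trans (qnormB_le _ _)) //.
    move: fg hr; rewrite !ltr_pdivlMr //; lra.
  have := ball _ _ fgh gap; rewrite hsum => leM.
  rewrite -[coord_sum B A h](addKr g) addrC (le_trans (qnormB_le _ _)) //.
  by rewrite ler_wpM2l // lerD2r (le_trans leM) // ler_norm.
exists F, (2 * M1 / t); first by rewrite divr_ge0 ?(ltW t0) // mulr_ge0.
move=> h A hF FA gA; have [h0|hN0] := eqVneq (qnorm h) 0.
  rewrite h0 mulr0 (qnorm_eq0 _ h0) -(scale0r (0 : X)) coord_sumZ scale0r.
  by rewrite qnorm0.
have h0 : 0 < qnorm h by rewrite lt0r hN0 qnorm_ge0.
(* Scaling by [a] brings [h] to quasi-norm [t / 2], strictly below [t]. *)
pose a := t / (2 * qnorm h); have a0 : 0 < a by rewrite divr_gt0 ?mulr_gt0.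
have an x : qnorm (scalar_of a *: x : X) = a * qnorm x.
  by rewrite qnormZ modulus_scalar_of gtr0_norm.
have := small (scalar_of a *: h) A; rewrite coord_sumZ !an => H.
rewrite mulrAC ler_pdivlMr //.
suff : a * qnorm (coord_sum B A h) <= M1.
  rewrite /a mulrAC ler_pdivrMr ?mulr_gt0 //.
  by rewrite [t * _]mulrC => /le_trans; apply; rewrite mulrCA mulrA.
apply: H => //.
- rewrite /a invfM mulrA -mulrA mulVf // mulr1 ltr_pdivrMr //.
  by rewrite mulr_natr mulr2n ltrDl.
- by move=> n nF; rewrite coordZ (hF n nF) mulr0.
- exact: gap_greedyZ.
Qed.

(** A vector [p] supported on [A] pushes those coordinates outward by [e], so that [A] becomes
    gap-greedy for [h + p], and the sum for [h] is recovered by subtracting [p]. *)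
Lemma greedy_le_of_gap_greedy_le F (D : R) : 0 <= D ->
  (forall h A, avoids F h -> [disjoint F & A]%fset -> gap_greedy h A ->
     qnorm (coord_sum B A h) <= D * qnorm h) ->
  forall h A, avoids F h -> [disjoint F & A]%fset -> greedy_set B h [set` A] ->
    qnorm (coord_sum B A h) <= C * (2 * C * D + 1) * qnorm h.
Proof.
move=> D0 DP h A hF FA gA; have [h0|hN0] := eqVneq (qnorm h) 0.
  rewrite h0 mulr0 (qnorm_eq0 _ h0) -(scale0r (0 : X)) coord_sumZ scale0r.
  by rewrite qnorm0.
have h0 : 0 < qnorm h by rewrite lt0r hN0 qnorm_ge0.
have [E E0 EP] := combination_le A.
have E1 : 0 < E + 1 by rewrite ltr_wpDl.
(* [E] depends on [A], but this [e] absorbs it: [qnorm p <= qnorm h], so the final constant is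
   independent of [A]. *)
pose e := qnorm h / (E + 1); have e0 : 0 < e by rewrite divr_gt0.
have [b bP] := choice (fun n => modulus_push (coord n h) _ (ltW e0)).
pose p := \sum_(n <- A) b n *: B n.
have coord_p n : coord n p = if n \in A then b n else 0 by exact: coord_combination.
have sump : coord_sum B A p = p.
  by apply: eq_big_seq => n nA; rewrite coord_p nA.
have pe : qnorm p <= qnorm h.
  rewrite (le_trans (EP b e (ltW e0) _)) // => [n _|]; first by have [->] := bP n.
  by rewrite mulrCA ger_pMr // ler_pdivrMr // mul1r lerDl.
have gap : gap_greedy (h + p) A.
  exists e => // n j nA jA; rewrite !coordD !coord_p nA (negPf jA) addr0.
  by have [_ ->] := bP n; rewrite lerD2r gA //; apply/negP.
have avoid : avoids F (h + p).
  move=> n nF; rewrite coordD coord_p hF // ifF ?addr0 //.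
  by apply/negbTE; move/fdisjointP: FA; apply.
have := DP _ _ avoid FA gap; rewrite coord_sumD sump => hp.
rewrite -[coord_sum B A h](addrK p) (le_trans (qnormB_le _ _)) //.
rewrite -mulrA ler_wpM2l // mulrDl mul1r lerD // (le_trans hp) //.
rewrite [2 * C * D]mulrC -mulrA ler_wpM2l // (le_trans (qnorm_add _ _)) //.
rewrite [2 * C]mulrC -mulrA ler_wpM2l //; lra.
Qed.

(** Subtracting [S_F(f)] leaves [h] vanishing on [F], and removing [F] from [A] leaves a greedy set
    of [h]. The part of the sum over [F] is controlled because [F] is fixed and finite. *)
Lemma quasi_greedy_of_greedy_le F (D : R) : 0 <= D ->
  (forall h A, avoids F h -> [disjoint F & A]%fset -> greedy_set B h [set` A] ->
     qnorm (coord_sum B A h) <= D * qnorm h) ->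
  quasi_greedy B.
Proof.
move=> D0 DP; have [E E0 EP] := coord_sum_le F.
exists (C * (E + D * (C * (1 + E)))) => f A gA.
pose h := f - coord_sum B F f.
have coord_h n : coord n h = if n \in F then 0 else coord n f.
  by rewrite coordB coord_coord_sum; case: ifP; rewrite ?subrr ?subr0.
have gAh : greedy_set B h [set` A `\` F]%fset.
  move=> n j /=; rewrite !inE => /andP[nF nA] /negP; rewrite !coord_h (negPf nF).
  have [jF|jF] := boolP (j \in F); first by rewrite modulus0 modulus_ge0.
  by move=> jA; apply: gA => //; exact/negP.
have hle : qnorm (coord_sum B (A `\` F)%fset h) <= D * qnorm h.
  apply: DP => // [n nF|]; first by rewrite coord_h nF.
  by apply/fdisjointP => n nF; rewrite inE nF.
rewrite (coord_sumID F) (le_trans (qnorm_add _ _)) // -mulrA ler_wpM2l //.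
rewrite mulrDl lerD ?EP ?fsubsetIr //.
have -> : coord_sum B (A `\` F)%fset f = coord_sum B (A `\` F)%fset h.
  by apply: eq_coord_sum => n; rewrite inE coord_h => /andP[/negPf->].
rewrite (le_trans hle) // -mulrA ler_wpM2l // (le_trans (qnormB_le _ _)) //.
by rewrite -mulrA ler_wpM2l // mulrDl mul1r lerD2l EP.
Qed.

End BasisCoordinates.

(** * Completeness and the Baire category argument *)

Section UniformBoundedness.
Context {R : realType} {k : scalar_kind} {X : quasiBanachType R k}.
Local Notation K := (scalars R k).
Implicit Types (f g : X) (A : {fset nat}).

Variable B : seq_basis X.
Local Notation coord n f := (coord_fun B n f : K).
Variables (C : R) (C_ge1 : 1 <= C).
Hypothesis qnorm_add : forall f g, qnorm (f + g) <= C * (qnorm f + qnorm g).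
Hypothesis coord_le : forall n f, modulus (coord n f) <= C * qnorm f.
Hypothesis vec_le : forall n, qnorm (B n) <= C.

Let C_gt0 : 0 < C. Proof. exact: lt_le_trans ltr01 C_ge1. Qed.
Let C_ge0 : 0 <= C. Proof. exact: ltW. Qed.

Let qnorm_chain f g h : qnorm (f - h) <= C * (qnorm (f - g) + qnorm (g - h)).
Proof. by rewrite -[f - h](subrKA g). Qed.

(** Dividing the radii by [2 * C] pays for the factor [C] lost at each use of the quasi-triangle
    inequality, so the total distance from [x n] to later centres stays below [2 * C * r n]. *)
Lemma nested_balls_cvg (x : nat -> X) (r : nat -> R) : (forall n, 0 < r n) ->
  (forall n, r n.+1 <= r n / (2 * C)) -> (forall n, qnorm (x n - x n.+1) < r n) ->
  exists f, forall n, qnorm (x n - f) < 4 * C ^+ 2 * r n.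
Proof.
move=> r0 rS xS.
have dist n i : qnorm (x n - x (n + i)%N) <= 2 * C * r n.
  elim: i n => [|i IH] n.
    by rewrite addn0 subrr qnorm0 !mulr_ge0 // ltW.
  rewrite (le_trans (qnorm_chain _ (x n.+1) _)) // -mulrA mulrCA ler_wpM2l //.
  have := IH n.+1; have := rS n; rewrite addSnnS ler_pdivlMr ?mulr_gt0 //.
  by have := xS n; lra.
(* The radii at least halve, and this weaker decay already yields an explicit Cauchy rank. *)
have rn n : r n * n.+1%:R <= r 0.
  elim: n => [|n]; first by rewrite mulr1.
  apply: le_trans.
  have r2 : r n.+1 <= r n / 2.
    rewrite (le_trans (rS n)) // ler_wpM2l ?(ltW (r0 n)) //.
    by rewrite lef_pV2 ?posrE ?mulr_gt0 // ler_peMr.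
  have rn0 : 0 <= r n * n%:R by rewrite mulr_ge0 // ltW.
  rewrite (le_trans (ler_wpM2r _ r2)) // -[n.+2%:R]natr1 -[n.+1%:R]natr1.
  by have := ltW (r0 n); lra.
have [f xf] : exists f : X, x @ \oo --> f.
  apply: qnorm_cauchy_cvg => E /=; rewrite qnorm_entourage => -[e /= e0 eE].
  pose N := Num.truncn (4 * C ^+ 2 * r 0 / e).
  have rN : 4 * C ^+ 2 * r N < e.
    have := truncnS_gt (4 * C ^+ 2 * r 0 / e); rewrite -/N ltr_pdivrMr // => H.
    rewrite -(@ltr_pM2r _ N.+1%:R) // [ltRHS]mulrC (le_lt_trans _ H) //.
    by rewrite -[leLHS]mulrA ler_wpM2l // mulr_ge0 // exprn_ge0.
  exists ([set g | exists2 n, (N <= n)%N & g = x n],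
          [set g | exists2 n, (N <= n)%N & g = x n]).
    by split; exists N => // n /= Nn; exists n.
  move=> [_ _] [/= [n Nn ->] [m Nm ->]]; apply: eE => /=.
  rewrite (le_lt_trans (qnorm_chain _ (x N) _)) // (le_lt_trans _ rN) //.
  rewrite expr2 [4 * _]mulrCA -2!mulrA ler_wpM2l //.
  have := dist N (n - N)%N; have := dist N (m - N)%N; rewrite !subnKC //.
  rewrite [qnorm (x n - _)]qnormB => Hm Hn.
  by rewrite (le_trans (lerD Hn Hm)) //; lra.
exists f => n.
have [i _ /(_ i) xfi] : \forall i \near \oo, qnorm (f - x (n + i)%N) < r n.
  have /qnorm_cvgP/(_ _ (r0 n))[N _ NP] := xf.
  by exists N => // i /= Ni; apply: NP => /=; rewrite (leq_trans Ni) // leq_addl.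
have {}xfi := xfi (leqnn _).
rewrite (le_lt_trans (qnorm_chain _ (x (n + i)%N) _)) //.
rewrite expr2 [4 * _]mulrCA -2!mulrA ltr_pM2l //.
rewrite [qnorm (_ - f)]qnormB.
have := dist n i; have : r n <= C * r n by rewrite ler_peMl // ltW.
have := r0 n; lra.
Qed.

(* The Baire category argument: otherwise nested balls around elements with
   ever larger sums over gap-greedy sets, a property stable under small
   perturbations, shrink to an element with unbounded greedy sums. *)
Lemma gap_greedy_sum_bounded_on_ball :
  (forall f, exists M : R, forall m, (1 <= m)%N -> qnorm (greedy_sum B f m) <= M) ->
  exists (f0 : X) (r M : R), 0 < r /\ forall f A, qnorm (f0 - f) < r ->
    gap_greedy B f A -> qnorm (coord_sum B A f) <= M.
Proof.
move=> bdd; apply: contrapT => nball.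
have large f0 r M : 0 < r -> exists f A,
    [/\ qnorm (f0 - f) < r, gap_greedy B f A & M < qnorm (coord_sum B A f)].
  move=> r0; apply: contrapT => nex; apply: nball.
  exists f0, r, M; split=> // f A fr gA.
  by rewrite leNgt; apply/negP => MA; apply: nex; exists f, A.
(* [p] holds a centre, a radius and the stage number, [q] the next centre and radius. *)
have step (p : (X * R) * nat) : exists q : X * R, 0 < p.1.2 ->
    [/\ 0 < q.2, q.2 <= p.1.2 / (2 * C), qnorm (p.1.1 - q.1) < p.1.2 &
      exists A, forall g, qnorm (q.1 - g) < 4 * C ^+ 2 * q.2 ->
        gap_greedy B g A /\ p.2%:R < qnorm (coord_sum B A g)].
  move: p => [[f0 r] j] /=; have [r0|] := ltP 0 r; last first.
    by exists (f0, r); rewrite ltNge => /negP.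
  (* The factor [C] and the extra 1 pay for passing from [f] to [g], as [S_A(f - g)] will have
     quasi-norm at most 1. *)
  have [f [A [f0f gA lA]]] := large f0 r (C * (j%:R + 1)) r0.
  have [r1 r10 r1P] := gap_greedy_near _ _ C_ge1 coord_le _ _ gA.
  have [D D0 DP] := coord_sum_le _ _ C_ge1 qnorm_add coord_le vec_le A.
  have C4 : 0 < 4 * C ^+ 2 by rewrite mulr_gt0 // exprn_gt0.
  have D1 : 0 < D + 1 by rewrite ltr_wpDl.
  pose r2 := Num.min r1 (D + 1)^-1.
  have r20 : 0 < r2 by rewrite lt_min r10 invr_gt0.
  (* The limit of the centres is only known to lie within [4 * C ^+ 2] radii of [f], hence the
     second bound. *)
  exists (f, Num.min (r / (2 * C)) (r2 / (4 * C ^+ 2))) => _ /=; split=> //.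
  - by rewrite lt_min !divr_gt0 // mulr_gt0.
  - by rewrite ge_min lexx.
  exists A => g fg.
  have {fg} : qnorm (f - g) < r2.
    rewrite (lt_le_trans fg) // mulrC -ler_pdivlMr // ge_min.
    by rewrite lexx orbT.
  rewrite lt_min => /andP[/r1P gAg]; rewrite -[_^-1]mul1r ltr_pdivlMr // => fg.
  split=> //; have := qnorm_add (coord_sum B A (f - g)) (coord_sum B A g).
  rewrite -coord_sumD subrK => /(lt_le_trans lA); rewrite ltr_pM2l //.
  have := DP A (f - g) (fsubset_refl _); have := qnorm_ge0 (f - g); lra.
have [next nextP] := choice step.
pose s := fix s n := if n is n'.+1 then next (s n', n') else (0 : X, 1 : R).
have s0 n : 0 < (s n).2.
  elim: n => [|n IH] /=; first exact: ltr01.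
  by have [] := nextP (s n, n) IH.
have sP n := nextP (s n, n) (s0 n).
have [f fP] : exists f, forall n, qnorm ((s n).1 - f) < 4 * C ^+ 2 * (s n).2.
  by apply: nested_balls_cvg => // n; have [] := sP n.
have [M MP] := bdd f.
have [_ _ _ [A /(_ f (fP (Num.truncn M).+2))[gA lA]]] := sP (Num.truncn M).+1.
(* The bound [M] covers greedy sums from rank 1 on; [A] is nonempty because its sum is nonzero. *)
have A0 : (0 < #|` A|)%N.
  rewrite cardfs_gt0; apply/eqP => AE.
  by move: lA; rewrite AE /coord_sum big_seq_fset0 qnorm0 ltNge /= ler0n.
have := MP _ A0; rewrite (gap_greedy_sum _ _ C_ge1 coord_le _ _ gA) leNgt.
by rewrite (lt_trans _ lA) // truncnS_gt.
Qed.

End UniformBoundedness.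

(** * Uniform constants from the hypotheses on the basis, and the equivalence *)

Lemma ereal_sup_range_lty {R : realType} (v : nat -> \bar R) :
  (ereal_sup (range v) < +oo)%E -> exists M : R, forall n, (v n <= M%:E)%E.
Proof.
move=> vy; have v_le n : (v n <= ereal_sup (range v))%E.
  by apply: ereal_sup_ubound; exists n.
case: ereal_sup v_le vy => [M v_le _|//|v_le _]; first by exists M.
by exists 0 => n; rewrite (le_trans (v_le n)) ?leNye.
Qed.

(** If [qnorm (B n)] times the dual norm is at most [M] and [qnorm (B n)] is at least [a > 0], the
    dual norms are at most [M / a]. *)
Lemma coord_le_exists {R : realType} {k : scalar_kind} {X : quasiNormedModType R k}
    (B : seq_basis X) : m_bounded B -> semi_normalized B ->
  exists c : R, forall n f, modulus (coord_fun B n f : scalars R k) <= c * qnorm f.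
Proof.
move=> Bbdd [inf0 _].
have dual_le n f :
    ((modulus (coord_fun B n f : scalars R k))%:E <=
       dual_norm (coord_fun B n) * (qnorm f)%:E)%E.
  have [h0|hN0] := eqVneq (qnorm f) 0.
    by rewrite h0 mule0 (qnorm_eq0 _ h0) (linear0 (coord_fun B n)) modulus0.
  have h0 : 0 < qnorm f by rewrite lt0r hN0 qnorm_ge0.
  rewrite -lee_pdivrMr // -EFinM; apply: ereal_sup_ubound.
  exists (scalar_of (qnorm f)^-1 *: f) => /=.
    by rewrite qnormZ modulus_scalar_of ger0_norm ?invr_ge0 ?qnorm_ge0 // mulVf.
  rewrite coordZ modulusM modulus_scalar_of ger0_norm ?invr_ge0 ?qnorm_ge0 //.
  by rewrite mulrC.
have [M MP] := ereal_sup_range_lty _ Bbdd.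
have inf_le n :
    (ereal_inf (range (fun n => (qnorm (B n))%:E)) <= (qnorm (B n))%:E)%E.
  by apply: ereal_inf_lbound; exists n.
have [a a0 aP] : exists2 a : R, 0 < a & forall n, a <= qnorm (B n).
  by case: ereal_inf inf0 inf_le => [a a0 aP|_ /(_ 0%N)//|//]; exists a.
exists (M / a) => n f; rewrite -lee_fin (le_trans (dual_le n f)) // EFinM.
rewrite lee_wpmul2r ?lee_fin ?qnorm_ge0 // EFinM lee_pdivlMr //.
rewrite (le_trans _ (MP n)) //.
rewrite muleC lee_wpmul2r ?lee_fin //.
apply: ereal_sup_ubound; exists 0; first by rewrite /= qnorm0.
by rewrite (linear0 (coord_fun B n)) modulus0.
Qed.

Theorem theorem3p1 (R : realType) (k : scalar_kind) (X : quasiBanachType R k)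
    (B : seq_basis X) (B_bounded : m_bounded B) (B_seminorm : semi_normalized B) :
  [<-> quasi_greedy B;
       forall f : X, exists g : X, greedy_series B f @ \oo --> g;
       forall f : X, exists M : R, forall m : nat, (1 <= m)%N ->
         qnorm (greedy_sum B f m) <= M].
Proof.
have [c1 c1P] := coord_le_exists _ B_bounded B_seminorm.
have [c2 c2P] := ereal_sup_range_lty _ B_seminorm.2.
have [c3 c31 c3P] := @qnorm_triangle R k X.
(* One constant bounds the quasi-triangle inequality, the functionals and the basis vectors. *)
pose C := Num.max c3 (Num.max c1 c2).
have C_ge1 : 1 <= C by rewrite le_max c31.
have qnorm_add (f g : X) : qnorm (f + g) <= C * (qnorm f + qnorm g).
  rewrite (le_trans (c3P f g)) // ler_wpM2r ?addr_ge0 ?qnorm_ge0 //.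
  by rewrite le_max lexx.
have coord_le n (f : X) : modulus (coord_fun B n f : scalars R k) <= C * qnorm f.
  rewrite (le_trans (c1P n f)) // ler_wpM2r ?qnorm_ge0 //.
  by rewrite !le_max lexx orbT.
have vec_le n : qnorm (B n) <= C.
  by rewrite !le_max -[qnorm _ <= c2]lee_fin c2P !orbT.
have tail := coord_tail _ _ C_ge1 coord_le.
tfae=> [qg f|cvg f|bdd].
- by exists f; exact: (quasi_greedy_cvg _ _ C_ge1).
- have [g fg] := cvg f; have [M MP] := qnorm_cvg_bounded _ C_ge1 qnorm_add _ _ fg.
  by exists M => m _; rewrite -(greedy_seriesE _ _ (tail f)).
- have [f0 [r [M [r0 ball]]]] :=
    gap_greedy_sum_bounded_on_ball _ _ C_ge1 qnorm_add coord_le vec_le bdd.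
  have [F [D D0 DP]] :=
    gap_greedy_le_of_ball _ _ C_ge1 qnorm_add coord_le _ _ _ r0 ball.
  apply: (quasi_greedy_of_greedy_le _ _ C_ge1 qnorm_add coord_le vec_le F); last first.
    exact: (greedy_le_of_gap_greedy_le _ _ C_ge1 qnorm_add vec_le F D).
  by have := le_trans ler01 C_ge1 => C0; rewrite mulr_ge0 // addr_ge0 // !mulr_ge0.
Qed.
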